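(* Let $N\ge2$, $M\ge N+1$ an integer and $\alpha\in(0,\infty)^{N+1}$. The continuous-time Markov chain on $\Delta^{(N)}_M$ generated by $\mathscr A^{(N)}_{M,\alpha}$ is irreducible and reversible with respect to $\mu^{(N)}_{M,\alpha}$. Moreover, $\mathscr A^{(N)}_{M,\alpha}$ has spectral gap $\alpha_{N+1}$ in $L^2(\mu^{(N)}_{M,\alpha})$.
   Context: $\Delta^{(N)}_M=\{x\in\frac1M\mathbb Z_+^N:|x|_1=\sum_{i=1}^Nx_i\le1\}$, $e_i$ the $i$-th standard unit vector. The generator is $$\mathscr A^{(N)}_{M,\alpha}f(x)=M\sum_{i=1}^N\Big\{\alpha_{N+1}x_i\big[f(x-\tfrac{e_i}M)-f(x)\big]+\alpha_i(1-|x|_1)\big[f(x+\tfrac{e_i}M)-f(x)\big]\Big\}+M^2\sum_{i=1}^N(1-|x|_1)x_i\Big\{f(x-\tfrac{e_i}M)+f(x+\tfrac{e_i}M)-2f(x)\Big\},$$ i.e. jump rates $q_{x,x-e_i/M}=Mx_i\alpha_{N+1}+M^2x_i(1-|x|_1)$, $q_{x,x+e_i/M}=\alpha_iM(1-|x|_1)+M^2x_i(1-|x|_1)$, and $0$ otherwise. The measure is $$\mu^{(N)}_{M,\alpha}(x)=\frac{[\alpha_{N+1}]_{M(1-|x|_1)}}{Z\,\{M(1-|x|_1)\}!}\prod_{i=1}^N\frac{[\alpha_i]_{Mx_i}}{(Mx_i)!},\qquad x\in\Delta^{(N)}_M,$$ with $[a]_m=\prod_{i=0}^{m-1}(a+i)$,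 $[a]_0=1$, and $Z$ the normalizing constant. The spectral gap is $\inf\{\mathcal E(f,f):\mu(f)=0,\mu(f^2)=1\}$ with $\mathcal E(f,f)=-\mu(f\,\mathscr A^{(N)}_{M,\alpha}f)$, $\mu=\mu^{(N)}_{M,\alpha}$. *)

(* Defs.v *)
From HB Require Import structures.
From mathcomp Require Import all_boot all_order all_algebra.
From mathcomp Require Import all_classical all_reals.
Set Implicit Arguments. Unset Strict Implicit. Unset Printing Implicit Defensive.
Import Order.TTheory GRing.Theory Num.Theory.
Local Open Scope ring_scope.

(* States of Delta^(N)_M, encoded by k = M x in Z_+^N with |k|_1 <= M. *)
Definition state (N M : nat) :=
  {k : {ffun 'I_N -> 'I_M.+1} | (\sum_(i < N) (k i : nat) <= M)%N}.

Section Chain.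
Variables (R : realType) (N M : nat) (alpha : 'I_N.+1 -> R).

Definition alpha_i (i : 'I_N) : R := alpha (widen_ord (leqnSn N) i).
Definition alpha_last : R := alpha ord_max.

Definition xcoord (x : state N M) (i : 'I_N) : R := ((val x i : nat)%:R) / M%:R.
Definition xnorm1 (x : state N M) : R := \sum_(i < N) xcoord x i.

Definition is_down (i : 'I_N) (x y : state N M) : bool :=
  ((val x i : nat) == (val y i).+1) && [forall j, (j != i) ==> (val x j == val y j)].
Definition is_up (i : 'I_N) (x y : state N M) : bool := is_down i y x.

Definition rate (x y : state N M) : R :=
  \sum_(i < N)
     ((if is_down i x y then
         M%:R * xcoord x i * alpha_last + M%:R ^+ 2 * xcoord x i * (1 - xnorm1 x)
       else 0)
    + (if is_up i x y then
         alpha_i i * M%:R * (1 - xnorm1 x) + M%:R ^+ 2 * xcoord x i * (1 - xnorm1 x)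
       else 0)).

Definition generator (f : state N M -> R) (x : state N M) : R :=
  \sum_(y : state N M) rate x y * (f y - f x).

Definition rising (a : R) (m : nat) : R := \prod_(i < m) (a + i%:R).

Definition mu_weight (x : state N M) : R :=
  let s := (\sum_(i < N) (val x i : nat))%N in
  rising alpha_last (M - s) / ((M - s)`!)%:R *
  \prod_(i < N) (rising (alpha_i i) (val x i) / ((val x i : nat)`!)%:R).

Definition Zconst : R := \sum_(x : state N M) mu_weight x.

Definition mu (x : state N M) : R := mu_weight x / Zconst.

Definition expect (f : state N M -> R) : R := \sum_(x : state N M) mu x * f x.

Definition dirichlet (f : state N M -> R) : R :=
  - expect (fun x => f x * generator f x).

Definition spectral_gap : R :=
  inf [set dirichlet f | f in
        [set f : state N M -> R | expect f = 0 /\ expect (fun x => f x ^+ 2) = 1]]%classic.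

Definition irreducible : Prop :=
  forall x y : state N M, connect [rel u v | 0 < rate u v] x y.

Definition reversible : Prop :=
  forall x y : state N M, mu x * rate x y = mu y * rate y x.

End Chain.

(* Main.v *)
(** Put k = Mx and regard the M - |k| vacancies as the particles of an extra
    site.  A centred linear function, i.e. [sum_l c_l k_l] with
    [sum_l c_l alpha_l = 0], is an eigenfunction for [- alpha_(N+1)], and such
    functions exist because N >= 2.  For the lower bound, the Dirichlet form
    attains its minimum over the admissible functions at an eigenfunction f
    (compactness and self-adjointness), so one has to bound below the eigenvalue
    [lam] of a non-constant f.  If some difference f(k + e_i) - f(k + e_j) is
    nonzero, comparing the eigenvalue equations at k + e_i and k + e_j at a
    maximum of this difference over k gives [lam >= alpha_(N+1)].  Otherwise f
    only depends on |k|, and the same maximum principle applied to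
    f(k + e_i) - f(k) gives the bound again. *)
Require Import Defs.
From HB Require Import structures.
From mathcomp Require Import all_boot all_order all_algebra.
From mathcomp Require Import all_classical all_reals.
From mathcomp Require Import topology normedtype derive ring lra zify.
Import Order.TTheory GRing.Theory Num.Theory.
Import numFieldNormedType.Exports.
Local Open Scope ring_scope.

Set Implicit Arguments.
Unset Strict Implicit.
Unset Printing Implicit Defensive.

(** * Reversible generators on a finite set and minimisers of their Dirichlet form *)

Section ReversibleGenerator.
Variables (R : realType) (T : finType) (p : T -> R) (q : T -> T -> R).
Hypothesis p_gt0 : forall x, 0 < p x.
Hypothesis balance : forall x y, p x * q x y = p y * q y x.

Let gen (f : T -> R) (x : T) : R := \sum_y q x y * (f y - f x).
Let dot (f g : T -> R) : R := \sum_x p x * (f x * g x).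
Let mean (f : T -> R) : R := \sum_x p x * f x.
Let energy (f : T -> R) : R := - dot f (gen f).
Let admissible (f : T -> R) := mean f = 0 /\ mean (fun x => f x ^+ 2) = 1.

(** The jump part of the form has kernel [p x * q x y], symmetric by [balance]; the rest is
    diagonal. *)
Lemma gen_self_adjoint f g : dot f (gen g) = dot g (gen f).
Proof.
have E u v : dot u (gen v) =
    \sum_x \sum_y p x * q x y * (u x * v y) - \sum_x p x * (u x * v x * \sum_y q x y).
  rewrite /dot -sumrB; apply: eq_bigr => x _.
  rewrite /gen !mulr_sumr -sumrB.
  by apply: eq_bigr => y _; ring.
rewrite !E; congr (_ - _); last by apply: eq_bigr => x _; ring.
rewrite exchange_big /=; apply: eq_bigr => x _; apply: eq_bigr => y _.
by rewrite balance; ring.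
Qed.

(** Self-adjointness tested against the constant 1, which the generator kills. *)
Lemma mean_gen f : mean (gen f) = 0.
Proof.
have := gen_self_adjoint (fun=> 1) f; rewrite /dot /mean.
under eq_bigr do rewrite mul1r.
move=> ->; apply: big1 => x _; rewrite /gen big1 ?mulr0 // => y _.
by rewrite subrr mulr0.
Qed.

Lemma dot_ge0 f : 0 <= dot f f.
Proof. by apply: sumr_ge0 => x _; rewrite -expr2 mulr_ge0 ?sqr_ge0 ?ltW. Qed.

Lemma dot_eq0 f x : dot f f = 0 -> f x = 0.
Proof.
move/eqP; rewrite psumr_eq0 => [/allP /(_ x (mem_index_enum _)) /=|y _].
  by rewrite mulf_eq0 gt_eqF //= mulf_eq0 orbb => /eqP.
by rewrite -expr2 mulr_ge0 ?sqr_ge0 ?ltW.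
Qed.

(** Functions on [T] become row vectors; positivity of [p] bounds the closed set of admissible ones,
    and the energy is continuous on this compact set. *)
Lemma energy_minimizer f0 : admissible f0 ->
  exists2 f, admissible f & forall g, admissible g -> energy f <= energy g.
Proof.
move=> adm0; pose n := #|T|.
pose fn (v : 'rV[R]_n) x := v ord0 (enum_rank x).
pose vec (f : T -> R) : 'rV[R]_n := \row_i f (enum_val i).
have fnK f : fn (vec f) = f by apply/funext => x; rewrite /fn mxE enum_rankK.
pose A := [set v : 'rV[R]_n | admissible (fn v)]%classic.
have fn_cont x : continuous (fn ^~ x) by apply: coord_continuous.
have sum_cont (F : T -> 'rV[R]_n -> R) : (forall x, continuous (F x)) ->
    continuous (fun v => \sum_x F x v).
  by move=> cF; apply: continuous_big => //; exact: add_continuous.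
have mul_cont (F G : 'rV[R]_n -> R) : continuous F -> continuous G ->
    continuous (fun v => F v * G v).
  by move=> cF cG v; apply: continuousM; [exact: cF|exact: cG].
have cst_cont (c : R) : continuous (fun _ : 'rV[R]_n => c) by apply: cst_continuous.
have mean_cont : continuous (fun v => mean (fn v)).
  by apply: (sum_cont) => x; apply: (mul_cont).
have mean2_cont : continuous (fun v => mean (fun x => fn v x ^+ 2)).
  apply: (sum_cont) => x; apply: (mul_cont); first exact: (cst_cont).
  exact: (mul_cont (fn^~ x) (fn^~ x)).
have energy_cont : continuous (fun v => energy (fn v)).
  move=> v; apply: continuousN; apply: (sum_cont) => x; apply: (mul_cont) => //.
  apply: (mul_cont) => //; apply: (sum_cont) => y; apply: (mul_cont) => // w.
  by apply: continuousB; exact: fn_cont.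
have Aclosed : closed A.
  apply: closedI.
    exact: ((iffLR (continuous_closedP _) mean_cont) _ (@closed_eq R 0)).
  exact: ((iffLR (continuous_closedP _) mean2_cont) _ (@closed_eq R 1)).
have Acompact : compact A.
  (* The second moment gives [v_i ^ 2 <= 1 / p_i]; adding 1 bounds [|v_i|] without a square root. *)
  pose b (i : 'I_n) : R := 1 + (p (enum_val i))^-1.
  pose B := [set v : 'rV[R]_n | forall i, `[- b i, b i]%classic (v ord0 i)]%classic.
  have cB : compact B.
    apply: (@rV_compact R n (fun i => `[- b i, b i]%classic)) => i.
    exact: segment_compact.
  apply: (@subclosed_compact _ A B Aclosed cB) => v [_ v1] i /=.
  rewrite in_itv /= -ler_norml.
  have pi0 := p_gt0 (enum_val i).
  have vi : (v ord0 i) ^+ 2 <= (p (enum_val i))^-1.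
    rewrite -[leRHS]mul1r ler_pdivlMr // mulrC -v1 /mean.
    rewrite (bigD1 (enum_val i)) //= {1}/fn enum_valK lerDl.
    by apply: sumr_ge0 => x _; rewrite mulr_ge0 ?sqr_ge0 ?ltW.
  have ip0 : 0 < (p (enum_val i))^-1 by rewrite invr_gt0.
  rewrite /b -real_normK ?num_real // in vi *.
  by rewrite leNgt; apply/negP => h; nra.
have A0 : (A !=set0)%classic by exists (vec f0); rewrite /A /= fnK.
have [c cA cmin] := compact_EVT_min A0 Acompact
  (@continuous_subspaceT _ _ A _ energy_cont).
exists (fn c); first by rewrite inE in cA.
move=> g gadm; rewrite -[g]fnK; apply: cmin.
by rewrite inE /A /= fnK.
Qed.

(* First variation: perturbing the minimiser [f] along [gen f + lam f] itself
   shows that this function has norm zero. *)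
Lemma minimizer_eigenfunction f : admissible f ->
  (forall g, admissible g -> energy f <= energy g) ->
  forall x, gen f x = - energy f * f x.
Proof.
move=> [f0 f1] fmin x; set lam := energy f.
pose u x := gen f x + lam * f x.
suff : dot u u = 0 by move=> /(@dot_eq0 _ x); rewrite /u; lra.
have mean_lin (a b : R) g h :
    mean (fun x => a * g x + b * h x) = a * mean g + b * mean h.
  by rewrite /mean !mulr_sumr -big_split /=; apply: eq_bigr => y _; ring.
have dot_lin (a b : R) g h k :
    dot k (fun x => a * g x + b * h x) = a * dot k g + b * dot k h.
  by rewrite /dot !mulr_sumr -big_split /=; apply: eq_bigr => y _; ring.
have dotC g h : dot g h = dot h g by apply: eq_bigr => y _; ring.
have dot_linl (a b : R) g h k :
    dot (fun x => a * g x + b * h x) k = a * dot g k + b * dot h k.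
  by rewrite dotC dot_lin !(dotC k).
have gen_lin (a b : R) g h : gen (fun x => a * g x + b * h x) =
    fun x => a * gen g x + b * gen h x.
  by apply/funext => y; rewrite /gen !mulr_sumr -big_split /=; apply: eq_bigr => z _; ring.
have mean2 g : mean (fun x => g x ^+ 2) = dot g g by [].
have u0 : mean u = 0.
  have -> : u = (fun x => 1 * gen f x + lam * f x) by apply/funext => y; rewrite mul1r.
  by rewrite mean_lin f0 mean_gen !mulr0 addr0.
(* Minimality extends by homogeneity from normalised to all centred functions. *)
have bound g : mean g = 0 -> lam * dot g g <= energy g.
  move=> g0; have := dot_ge0 g; rewrite le_eqVlt => /orP[/eqP gg|gg].
    rewrite -gg mulr0 /energy /dot big1 ?oppr0 // => y _.
    by rewrite (@dot_eq0 g y) // mul0r mulr0.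
  pose s := Num.sqrt (dot g g).
  have s0 : 0 < s by rewrite sqrtr_gt0.
  have ss : s ^+ 2 = dot g g by rewrite sqr_sqrtr // ltW.
  have E : (fun x => s^-1 * g x) = (fun x => s^-1 * g x + 0 * g x).
    by apply/funext => y; rewrite mul0r addr0.
  have adm : admissible (fun x => s^-1 * g x).
    rewrite /admissible mean2 E mean_lin dot_lin dot_linl g0 -ss.
    by split; [ring|field; rewrite gt_eqF].
  have := fmin _ adm; rewrite -/lam /energy E gen_lin dot_lin dot_linl.
  rewrite !mul0r !addr0 mulrA -invfM -expr2 ss => h.
  by rewrite mulrC -ler_pdivlMl //; lra.
have duu : dot u u = dot u (gen f) + lam * dot u f.
  rewrite -[dot u (gen f)]mul1r -dot_lin; apply: eq_bigr => y _.
  by rewrite {2}/u mul1r.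
(* This is [bound] at [f + t u]: the constant term cancels and, by self-adjointness, the linear
   coefficient is [- 2 * dot u u]. *)
have quad t : 0 <= - 2 * t * dot u u + t ^+ 2 * (energy u - lam * dot u u).
  have := bound (fun x => 1 * f x + t * u x).
  rewrite mean_lin f0 u0 !mulr0 addr0 => /(_ erefl).
  rewrite /energy gen_lin !(dot_lin, dot_linl).
  have := gen_self_adjoint f u; have : dot f f = 1 by rewrite -f1.
  have : lam = - dot f (gen f) by [].
  rewrite duu (dotC u f).
  by move=> lamE -> ->; rewrite lamE; lra.
apply/eqP; rewrite eq_le dot_ge0 andbT leNgt; apply/negP => uu0.
(* For [t = dot u u / (|C| + 1)] one has [t * C < dot u u], so the quadratic falls below
   [- t * dot u u < 0]. *)
pose C := energy u - lam * dot u u.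
have C0 : 0 < `|C| + 1 by rewrite ltr_wpDl.
have t0 : 0 < dot u u / (`|C| + 1) by rewrite divr_gt0.
have := quad (dot u u / (`|C| + 1)); rewrite -/C.
have tC : dot u u / (`|C| + 1) * (`|C| + 1) = dot u u by rewrite divfK ?gt_eqF.
have := ler_norm C; move: t0 tC; set t := _ / _ => t0 tC CC.
nra.
Qed.

End ReversibleGenerator.

(** * Occupation numbers and single-particle moves *)

Section Counts.
Variables N M : nat.
Implicit Types (k : 'I_N -> nat) (i j l : 'I_N) (x y : state N M).

Definition occ x i : nat := val x i.
Definition mass k : nat := (\sum_i k i)%N.

Lemma mass_occ x : (mass (occ x) <= M)%N.
Proof. exact: (valP x). Qed.

Lemma state_eq x y : occ x =1 occ y -> x = y.
Proof. by move=> xy; apply/val_inj/ffunP => i; apply/val_inj/xy. Qed.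

Fact zero_state_subproof :
  (\sum_(i < N) ([ffun=> ord0] : {ffun 'I_N -> 'I_M.+1}) i <= M)%N.
Proof. by rewrite big1 // => i _; rewrite ffunE. Qed.

Definition zero_state : state N M := Sub [ffun=> ord0] zero_state_subproof.

(** Total in [k], so that moves can be written on plain functions; the value is meaningful only when
    [mass k <= M]. *)
Definition of_occ k : state N M :=
  insubd zero_state [ffun i => inord (k i)].

Lemma leq_mass k i : (k i <= mass k)%N.
Proof. by rewrite /mass (bigD1 i) //= leq_addr. Qed.

Lemma of_occK k : (mass k <= M)%N -> occ (of_occ k) = k.
Proof.
move=> kM; have ki i : (inord (k i) : 'I_M.+1) = k i :> nat.
  by rewrite inordK // ltnS (leq_trans (leq_mass k i)).
apply/funext => i; rewrite /occ /of_occ val_insubd.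
case: ifP => [_|/negP[]]; first by rewrite ffunE ki.
rewrite (leq_trans _ kM) //; apply: leq_sum => j _; by rewrite ffunE ki.
Qed.

Lemma occK : cancel occ of_occ.
Proof. by move=> x; apply: state_eq => i; rewrite of_occK ?mass_occ. Qed.

Definition incr k i j : nat := (k j + (j == i))%N.
(** Truncated: an empty site stays empty, and such a move has coefficient 0 in the generator. *)
Definition decr k i j : nat := (k j - (j == i))%N.

Lemma incrC k i j : incr (incr k i) j = incr (incr k j) i.
Proof. by apply/funext => l; rewrite /incr addnAC. Qed.

Lemma incrK k i : decr (incr k i) i = k.
Proof. by apply/funext => l; rewrite /incr /decr addnK. Qed.

Lemma decrK k i : (0 < k i)%N -> incr (decr k i) i = k.
Proof.
move=> ki; apply/funext => l; rewrite /incr /decr; case: eqP => [->|_]; lia.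
Qed.

Lemma decr_incr k i j : (0 < k j)%N -> decr (incr k i) j = incr (decr k j) i.
Proof. by move=> kj; rewrite -{1}(decrK kj) incrC incrK. Qed.

Lemma mass_incr k i : mass (incr k i) = (mass k).+1.
Proof.
rewrite /mass /incr big_split /= -addn1; congr addn.
by rewrite (bigD1 i) //= eqxx big1 // => j /negPf ->.
Qed.

Lemma mass_decr k i : (0 < k i)%N -> (mass (decr k i)).+1 = mass k.
Proof. by move=> ki; rewrite -(mass_incr _ i) decrK. Qed.

Lemma mass_decr_leq k i : (mass (decr k i) <= mass k)%N.
Proof. by apply: leq_sum => j _; rewrite leq_subr. Qed.

Lemma is_downE i x y : is_down i x y = (occ x == incr (occ y) i :> (_ -> _)).
Proof.
apply/andP/eqP => [[/eqP xi /forallP xj]|xy].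
  apply/funext => j; rewrite /incr /occ.
  have [->|ji] := eqVneq j i; first by rewrite xi addn1.
  by have := xj j; rewrite ji /= => /eqP ->; rewrite addn0.
have xyE j : val x j = incr (occ y) i j :> nat by rewrite -xy.
split; first by rewrite xyE /incr eqxx addn1.
apply/forallP => j; apply/implyP => /negPf ji; apply/eqP/val_inj.
by rewrite /= xyE /incr ji addn0.
Qed.

Lemma is_down_decr i x y : (0 < occ x i)%N ->
  is_down i x y = (y == of_occ (decr (occ x) i)).
Proof.
move=> xi; rewrite is_downE; apply/eqP/eqP => [->|->]; first by rewrite incrK occK.
rewrite of_occK ?decrK // (leq_trans (mass_decr_leq _ _)) ?mass_occ //.
Qed.

Lemma is_up_incr i x y : (mass (occ x) < M)%N ->
  is_up i x y = (y == of_occ (incr (occ x) i)).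
Proof.
move=> xi; rewrite /is_up is_downE; apply/eqP/eqP => [<-|->]; first by rewrite occK.
by rewrite of_occK // mass_incr.
Qed.

End Counts.

(** * Rates, reversibility and irreducibility *)

Section Chain.
Variables (R : realType) (N M : nat) (alpha : 'I_N.+1 -> R).
Hypothesis M_gt0 : (0 < M)%N.
Hypothesis alpha_gt0 : forall i, 0 < alpha i.
Implicit Types (k : 'I_N -> nat) (i j l : 'I_N) (x y : state N M) (f : state N M -> R).

Notation a := (alpha_i alpha).
Notation a0 := (alpha_last alpha).

Let a_gt0 i : 0 < a i. Proof. exact: alpha_gt0. Qed.
Let a0_gt0 : 0 < a0. Proof. exact: alpha_gt0. Qed.

Definition vacant k : nat := (M - mass k)%N.

(** As [M * x_i] and [M * (1 - |x|_1)] are the occupations of site i and of the vacant site, each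
    rate is the source occupation times the sum of target parameter and target occupation. *)
Lemma rateE x y : rate alpha x y = \sum_i
  ((if is_down i x y then (occ x i)%:R * (a0 + (vacant (occ x))%:R) else 0)
 + (if is_up i x y then (vacant (occ x))%:R * (a i + (occ x i)%:R) else 0)).
Proof.
have M0 : M%:R != 0 :> R by rewrite pnatr_eq0 -lt0n.
have xcE i : M%:R * xcoord R x i = (occ x i)%:R by rewrite /xcoord mulrC divfK.
have x1E : M%:R * (1 - xnorm1 R x) = (vacant (occ x))%:R.
  rewrite mulrBr mulr1 /xnorm1 mulr_sumr natrB ?mass_occ // natr_sum.
  by congr (_ - _); apply: eq_bigr => i _; exact: xcE.
apply: eq_bigr => i _; congr (_ + _); case: ifP => // _.
  by rewrite -xcE -x1E; ring.
by rewrite -xcE -x1E; ring.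
Qed.

Lemma rising_gt0 (b : R) m : 0 < b -> 0 < rising b m.
Proof. by move=> b0; apply: prodr_gt0 => i _; rewrite ltr_wpDr. Qed.

Lemma risingS (b : R) m : rising b m.+1 = rising b m * (b + m%:R).
Proof. by rewrite /rising big_ord_recr. Qed.

Lemma mu_weightE x : mu_weight alpha x =
  rising a0 (vacant (occ x)) / (vacant (occ x))`!%:R *
  \prod_i (rising (a i) (occ x i) / (occ x i)`!%:R).
Proof. by []. Qed.

Lemma fact_natr_gt0 m : 0 < m`!%:R :> R.
Proof. by rewrite ltr0n fact_gt0. Qed.

Lemma mu_weight_gt0 x : 0 < mu_weight alpha x.
Proof.
rewrite mu_weightE mulr_gt0 ?divr_gt0 ?rising_gt0 ?fact_natr_gt0 //.
by apply: prodr_gt0 => i _; rewrite divr_gt0 ?rising_gt0 ?fact_natr_gt0.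
Qed.

Lemma mu_gt0 x : 0 < mu alpha x.
Proof.
rewrite /mu divr_gt0 ?mu_weight_gt0 // /Zconst (bigD1 x) //=.
by rewrite ltr_pwDl ?mu_weight_gt0 // sumr_ge0 // => y _; rewrite ltW ?mu_weight_gt0.
Qed.

(** The move affects two factors of the weight; raising m by one multiplies [rising b m / m!] by
    [(b + m) / (m + 1)]. *)
Lemma mu_weight_down i x y : is_down i x y ->
  mu_weight alpha x * ((occ x i)%:R * (a0 + (vacant (occ x))%:R)) =
  mu_weight alpha y * ((vacant (occ y))%:R * (a i + (occ y i)%:R)).
Proof.
rewrite is_downE => /eqP xy; rewrite !mu_weightE.
have vy : vacant (occ y) = (vacant (occ x)).+1.
  have := mass_occ x; rewrite /vacant xy mass_incr; lia.
have xi : occ x i = (occ y i).+1 by rewrite xy /incr eqxx addn1.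
rewrite vy [in LHS](bigD1 i) //= [in RHS](bigD1 i) //= xi.
have -> : \prod_(j < N | j != i) (rising (a j) (occ x j) / (occ x j)`!%:R) =
          \prod_(j < N | j != i) (rising (a j) (occ y j) / (occ y j)`!%:R) :> R.
  by apply: eq_bigr => j /negPf ji; rewrite xy /incr ji addn0.
rewrite !risingS !factS !natrM.
field.
by rewrite !(gt_eqF (fact_natr_gt0 _)) !nat1r !pnatr_eq0.
Qed.

Lemma chain_reversible : reversible M alpha.
Proof.
move=> x y; rewrite /mu mulrAC [RHS]mulrAC; congr (_ * _).
rewrite !rateE !mulr_sumr; apply: eq_bigr => i _; rewrite addrC mulrDr [RHS]mulrDr.
congr (_ + _).
  rewrite /is_up; case: ifP => [yx|_]; last by rewrite !mulr0.
  by rewrite (mu_weight_down yx).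
rewrite /is_up; case: ifP => [xy|_]; last by rewrite !mulr0.
by rewrite (mu_weight_down xy).
Qed.

(** Reversibility makes connectivity symmetric, so it suffices to empty every state one particle at
    a time. *)
Lemma chain_irreducible : irreducible M alpha.
Proof.
have e_sym : connect_sym [rel u v : state N M | 0 < rate alpha u v].
  apply: sym_connect_sym => u v /=.
  rewrite -(pmulr_rgt0 _ (mu_gt0 u)) chain_reversible pmulr_rgt0 //.
  exact: mu_gt0.
suff to0 x : connect [rel u v | 0 < rate alpha u v] x (zero_state N M).
  by move=> x y; rewrite (connect_trans (to0 x)) // e_sym.
have [n] := ubnP (mass (occ x)); elim: n x => // n IHn x xn.
have [/forallP x0|] := boolP [forall i, occ x i == 0%N].
  suff -> : x = zero_state N M by exact: connect0.
  by apply: state_eq => i; rewrite (eqP (x0 i)) /occ /= ffunE.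
rewrite negb_forall => /existsP[i]; rewrite -lt0n => xi.
have xM := mass_occ x.
pose y := of_occ M (decr (occ x) i).
have yE : occ y = decr (occ x) i.
  by rewrite of_occK // (leq_trans (mass_decr_leq _ _)).
apply: (@connect_trans _ _ y); last first.
  by apply: IHn; rewrite yE; have := mass_decr xi; lia.
apply: connect1 => /=; rewrite rateE (bigD1 i) //= is_down_decr // eqxx.
apply: ltr_pwDl.
  apply: ltr_pwDl; first by rewrite mulr_gt0 ?ltr0n // ltr_wpDr.
  by case: ifP => // _; rewrite mulr_ge0 ?addr_ge0 // ltW.
apply: sumr_ge0 => j _; apply: addr_ge0; case: ifP => // _;
  by rewrite mulr_ge0 ?addr_ge0 // ltW.
Qed.

(** * The generator in occupation numbers *)

(** Boundary configurations need no separate formula: the coefficient of an impossible move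
    vanishes. *)
Lemma generatorE f k : (mass k <= M)%N ->
  generator alpha f (of_occ M k) = \sum_i
   ((k i)%:R * (a0 + (vacant k)%:R) * (f (of_occ M (decr k i)) - f (of_occ M k))
  + (vacant k)%:R * (a i + (k i)%:R) * (f (of_occ M (incr k i)) - f (of_occ M k))).
Proof.
move=> kM; set x := of_occ M k.
have xE : occ x = k by exact: of_occK.
rewrite /generator; under eq_bigr do rewrite rateE mulr_suml.
rewrite exchange_big /=; apply: eq_bigr => i _.
under eq_bigr do rewrite mulrDl.
rewrite big_split /= xE; congr (_ + _).
  case: (posnP (k i)) => [ki|ki].
    rewrite ki !mul0r big1 // => y _; by rewrite if_same mul0r.
  under eq_bigr do rewrite is_down_decr ?xE //.
  rewrite (bigD1 (of_occ M (decr k i))) //= eqxx big1 ?addr0 // => y /negPf ->.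
  by rewrite mul0r.
have [kM'|kM'] := ltnP (mass k) M.
  under eq_bigr do rewrite is_up_incr ?xE //.
  rewrite (bigD1 (of_occ M (incr k i))) //= eqxx big1 ?addr0 // => y /negPf ->.
  by rewrite mul0r.
have -> : vacant k = 0%N by rewrite /vacant; lia.
by rewrite !mul0r big1 // => y _; rewrite if_same mul0r.
Qed.

(** * Maximum principle for eigenfunctions *)

Lemma vacant_incr k i : vacant (incr k i) = (vacant k).-1.
Proof. by rewrite /vacant mass_incr; lia. Qed.

(** The last two terms isolate the effect of the extra particle: its own jump to the vacant site and
    the [v] vacancies it attracts. The coefficients in the sum do not depend on [i], so the formulas
    for two sites subtract termwise. *)
Lemma generator_incr f k i : (mass k < M)%N ->
  let F k' := f (of_occ M k') in let v := (vacant k).-1%:R in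
  generator alpha f (of_occ M (incr k i)) = \sum_l
   ((k l)%:R * (a0 + v) * (F (incr (decr k l) i) - F (incr k i))
  + v * (a l + (k l)%:R) * (F (incr (incr k l) i) - F (incr k i)))
  + (a0 + v) * (F k - F (incr k i)) + v * (F (incr (incr k i) i) - F (incr k i)).
Proof.
move=> kM F v; rewrite generatorE ?mass_incr // vacant_incr -/v.
have delta (c : R) : c = \sum_l (l == i)%:R * c.
  by rewrite (bigD1 i) //= eqxx mul1r big1 ?addr0 // => l /negPf ->; rewrite mul0r.
rewrite -[RHS]addrA [X in _ = _ + X]delta -big_split /=.
apply: eq_bigr => l _.
rewrite (_ : (incr k i l)%:R = (k l)%:R + (l == i)%:R) -?natrD // -!/(F _).
have [->|li] := eqVneq l i.
  rewrite incrK.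
  have [ki|ki] := posnP (k i); first by rewrite ki /=; ring.
  by rewrite (decrK ki) /=; ring.
have [kl|kl] := posnP (k l); rewrite incrC.
  by rewrite kl /=; ring.
by rewrite decr_incr //=; ring.
Qed.

(* The difference [f (k + e_i) - f (k + e_j)] at a maximum: the jumps common to
   both configurations do not increase it, the jump of the extra particle to the
   vacant site removes it at rate [a0 + v], and the [v] extra jumps of vacancies
   towards it double it at most. *)
Lemma swap_gap f lam i j k :
  (forall x, generator alpha f x = - lam * f x) ->
  let D k' := f (of_occ M (incr k' i)) - f (of_occ M (incr k' j)) in
  (mass k < M)%N -> (forall k', (mass k' < M)%N -> D k' <= D k) -> 0 < D k ->
  a0 <= lam.
Proof.
move=> eig D kM Dmax D0.
have eqi := generator_incr f i kM; have eqj := generator_incr f j kM.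
move: eqi eqj; rewrite !eig /=; set v : R := _%:R.
set S1 := \sum_l _; set S2 := \sum_l _ => eqi eqj.
have v0 : 0 <= v by rewrite ler0n.
have S12 : S1 - S2 <= 0.
  rewrite -sumrB; apply: sumr_le0 => l _.
  have down : (k l)%:R * (a0 + v) * (D (decr k l) - D k) <= 0.
    apply: mulr_ge0_le0; first by rewrite mulr_ge0 ?addr_ge0 // ltW.
    rewrite subr_le0 Dmax //; exact: leq_ltn_trans (mass_decr_leq _ _) kM.
  have up : v * (a l + (k l)%:R) * (D (incr k l) - D k) <= 0.
    (* If [mass k = M - 1], then [incr k l] lies outside the range of the maximum, but [v = 0]. *)
    have [kM'|kM'] := ltnP (mass k).+1 M.
      apply: mulr_ge0_le0; first by rewrite mulr_ge0 ?addr_ge0 // ltW.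
      by rewrite subr_le0 Dmax // mass_incr.
    have -> : v = 0 by rewrite /v (_ : (vacant k).-1 = 0%N) // /vacant; lia.
    by rewrite !mul0r.
  by move: down up; rewrite /D; lra.
(* The sum on the left telescopes through [k + e_i + e_j] to the difference of [f] at [k + 2 e_i]
   and [k + 2 e_j]. *)
have Dij : v * (D (incr k i) + D (incr k j)) <= v * (D k + D k).
  have [kM'|kM'] := ltnP (mass k).+1 M.
    by rewrite ler_wpM2l // lerD // Dmax // mass_incr.
  have -> : v = 0 by rewrite /v (_ : (vacant k).-1 = 0%N) // /vacant; lia.
  by rewrite !mul0r.
have : (a0 - lam) * D k <= 0.
  move: S12 Dij eqi eqj; rewrite /D (incrC k i j).
  lra.
by rewrite pmulr_lle0 // subr_le0.
Qed.

(** The equations at [k + e_i0] and [k] are subtracted, [k] having one more vacancy. By [fij] all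
    increments reduce to values of [h]; at the maximum the sums contribute at most 0 and the extra
    particle at most [- a0 * h k]. *)
Lemma incr_gap f lam k :
  (forall x, generator alpha f x = - lam * f x) ->
  (forall k' i j, (mass k' < M)%N -> f (of_occ M (incr k' i)) = f (of_occ M (incr k' j))) ->
  forall i0, let h k' := f (of_occ M (incr k' i0)) - f (of_occ M k') in
  (mass k < M)%N -> (forall k', (mass k' < M)%N -> h k' <= h k) -> 0 < h k ->
  a0 <= lam.
Proof.
move=> eig fij i0 h kM hmax h0.
have eqi := generator_incr f i0 kM; have eqk := generatorE f (ltnW kM).
move: eqi eqk; rewrite !eig /= -/(h _).
have -> : (vacant k)%:R = (vacant k).-1%:R + 1 :> R.
  by rewrite -[in LHS](prednK (_ : 0 < vacant k)%N) ?mulrSr // /vacant; lia.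
set v : R := (_.-1)%:R => eqi eqk.
have v0 : 0 <= v by rewrite ler0n.
have Fdec l : (0 < k l)%N -> f (of_occ M (incr (decr k l) i0)) = f (of_occ M k).
  move=> kl; rewrite (fij _ i0 l) ?decrK //.
  exact: leq_ltn_trans (mass_decr_leq _ _) kM.
have hinc l : v * h (incr k l) <= v * h k.
  have [kM'|kM'] := ltnP (mass k).+1 M.
    by rewrite ler_wpM2l // hmax // mass_incr.
  have -> : v = 0 by rewrite /v (_ : (vacant k).-1 = 0%N) // /vacant; lia.
  by rewrite !mul0r.
move: eqi eqk; set S1 := \sum_l _; set S2 := \sum_l _ => eqi eqk.
have S12 : S1 - S2 <= 0.
  rewrite -sumrB; apply: sumr_le0 => l _; rewrite -!/(h _).
  have up := ler_wpM2l (addr_ge0 (ltW (a_gt0 l)) (ler0n R (k l))) (hinc l).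
  have ah : 0 <= a l * h k by rewrite mulr_ge0 // ltW.
  have hE : f (of_occ M (incr k l)) = f (of_occ M (incr k i0)) by exact: fij.
  have [kl|kl] := posnP (k l).
    move: up ah; rewrite kl /h hE; lra.
  have down : (k l)%:R * (a0 + (v + 1)) * h (decr k l) <= (k l)%:R * (a0 + (v + 1)) * h k.
    apply: ler_wpM2l; first by rewrite mulr_ge0 ?addr_ge0 // ltW.
    by rewrite hmax // (leq_ltn_trans (mass_decr_leq _ _) kM).
  (* Together, [up] and [down] bound the l-th term by [- a l * h k]. *)
  by move: up down ah; rewrite /h hE Fdec //; lra.
have hi := hinc i0.
have : (a0 - lam) * h k <= 0 by move: S12 hi eqi eqk; rewrite /h; lra.
by rewrite pmulr_lle0 // subr_le0.
Qed.

(** Such [k] are occupations of states, hence finite in number; [0 < M] makes the empty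
    configuration one of them. *)
Lemma exists_max (D : ('I_N -> nat) -> R) : exists2 k, (mass k < M)%N &
  forall k', (mass k' < M)%N -> D k' <= D k.
Proof.
have m0 : (mass (occ (zero_state N M)) < M)%N.
  by rewrite /mass big1 // => i _; rewrite /occ /= ffunE.
case: (@arg_maxP _ _ _ (zero_state N M) (fun x => mass (occ x) < M)%N (D \o @occ N M) m0).
move=> x xM xmax; exists (occ x) => // k kM.
by have := xmax (of_occ M k); rewrite /= of_occK ?(ltnW kM) //; apply.
Qed.

Lemma eigenvalue_ge f lam (i0 : 'I_N) x y :
  (forall x, generator alpha f x = - lam * f x) -> f x != f y -> a0 <= lam.
Proof.
move=> eig fxy.
have [[i [j [k [kM Dk]]]]|noD] := pselect (exists i j k, (mass k < M)%N /\
    0 < f (of_occ M (incr k i)) - f (of_occ M (incr k j))).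
  have [k' k'M max] := exists_max
    (fun k => f (of_occ M (incr k i)) - f (of_occ M (incr k j))).
  by apply: (swap_gap eig k'M max); exact: lt_le_trans Dk (max _ kM).
have fij k i j : (mass k < M)%N -> f (of_occ M (incr k i)) = f (of_occ M (incr k j)).
  move=> kM; apply/eqP; rewrite eq_le -subr_le0 -[X in _ && X]subr_le0 !leNgt.
  by apply/andP; split; apply/negP => ?; apply: noD; [exists i, j, k|exists j, i, k].
(* Stated for a general [g], to be applied to [f] and [- f], because the maximum principle needs a
   positive difference. For swaps, exchanging i and j changes the sign. *)
have pos g : (forall x, generator alpha g x = - lam * g x) ->
    (forall k i j, (mass k < M)%N -> g (of_occ M (incr k i)) = g (of_occ M (incr k j))) ->
    (exists2 k, (mass k < M)%N & 0 < g (of_occ M (incr k i0)) - g (of_occ M k)) ->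
    a0 <= lam.
  move=> eigg gij [k kM gk].
  have [k' k'M max] := exists_max (fun k => g (of_occ M (incr k i0)) - g (of_occ M k)).
  by apply: (incr_gap eigg gij k'M max); exact: lt_le_trans gk (max _ kM).
have [up|noup] := pselect (exists2 k, (mass k < M)%N &
  0 < f (of_occ M (incr k i0)) - f (of_occ M k)); first exact: (pos f).
have [down|nodown] := pselect (exists2 k, (mass k < M)%N &
    0 < - f (of_occ M (incr k i0)) - - f (of_occ M k)).
  apply: (pos (fun x => - f x)) => // [z|k i j kM]; last by rewrite (fij k i j).
  rewrite mulrN -eig /generator -sumrN; apply: eq_bigr => w _; ring.
have step k i : (mass k < M)%N -> f (of_occ M (incr k i)) = f (of_occ M k).
  move=> kM; rewrite (fij _ i i0) //; apply/eqP; rewrite eq_le !leNgt.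
  apply/andP; split; apply/negP => ?; [apply: noup|apply: nodown]; exists k => //; lra.
(* No move changes [f], so emptying the state shows that [f] is constant. *)
suff const z : f z = f (zero_state N M) by rewrite !const eqxx in fxy.
have [n] := ubnP (mass (occ z)); elim: n z => // n IHn z zn.
have [/forallP z0|] := boolP [forall i, occ z i == 0%N].
  by congr f; apply: state_eq => i; rewrite (eqP (z0 i)) /occ /= ffunE.
rewrite negb_forall => /existsP[i]; rewrite -lt0n => zi.
have zM := mass_occ z; have zdec := mass_decr zi.
rewrite -[z in LHS]occK -(decrK zi) step; last by lia.
by apply: IHn; rewrite of_occK; lia.
Qed.

(** * Linear eigenfunctions and the upper bound *)

(** Gains and losses at site l both contain the product of [vacant] and the occupation of l; these
    cancel and leave a linear drift. *)
Lemma generator_linear (c : 'I_N -> R) x :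
  generator alpha (fun z => \sum_l c l * (occ z l)%:R) x =
  \sum_l c l * ((vacant (occ x))%:R * a l - a0 * (occ x l)%:R).
Proof.
set f := fun z => _.
rewrite -[x in LHS]occK generatorE ?mass_occ //; apply: eq_bigr => l _.
set k := occ x.
have kM : (mass k <= M)%N by exact: mass_occ.
have delta : c l = \sum_j c j * (j == l)%:R.
  by rewrite (bigD1 l) //= eqxx mulr1 big1 ?addr0 // => j /negPf ->; rewrite mulr0.
have down : (k l)%:R * (f (of_occ M (decr k l)) - f (of_occ M k)) = - (k l)%:R * c l.
  have [kl|kl] := posnP (k l); first by rewrite kl; ring.
  rewrite mulNr -mulrN; congr (_ * _).
  rewrite /f !of_occK ?(leq_trans (mass_decr_leq _ _)) // -sumrB delta -sumrN.
  apply: eq_bigr => j _; rewrite /decr natrB; first ring.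
  by case: eqP => // ->.
have up : (vacant k)%:R * (f (of_occ M (incr k l)) - f (of_occ M k)) =
    (vacant k)%:R * c l.
  have [kM'|kM'] := ltnP (mass k) M; last first.
    by have -> : vacant k = 0%N by [rewrite /vacant; lia]; rewrite !mul0r.
  congr (_ * _); rewrite /f !of_occK ?mass_incr // -sumrB [RHS]delta.
  by apply: eq_bigr => j _; rewrite /incr natrD; ring.
rewrite mulrAC down [X in _ + X]mulrAC up; ring.
Qed.

Lemma centered_linear_eigenfunction (c : 'I_N -> R) x : \sum_l c l * a l = 0 ->
  let f z := \sum_l c l * (occ z l)%:R in
  generator alpha f x = - a0 * f x.
Proof.
move=> ca f; rewrite generator_linear.
transitivity ((vacant (occ x))%:R * (\sum_l c l * a l) - a0 * f x); last first.
  by rewrite ca; ring.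
by rewrite !mulr_sumr -sumrB; apply: eq_bigr => l _; ring.
Qed.

Lemma gap_attained (i j : 'I_N) : i != j ->
  exists f, [/\ expect alpha f = 0, expect alpha (fun x => f x ^+ 2) = 1 &
    dirichlet alpha f = a0].
Proof.
move=> ij.
(* A nonzero vector supported on two sites and orthogonal to [a]. *)
pose c l := a j * (l == i)%:R - a i * (l == j)%:R.
have cE (g : 'I_N -> R) : \sum_l c l * g l = a j * g i - a i * g j.
  rewrite (bigD1 i) //= (bigD1 j) ?(eq_sym j) //= /c !eqxx (eq_sym j) (negPf ij).
  rewrite big1 => [|l /andP[/negPf -> /negPf ->]] /=; ring.
have ca : \sum_l c l * a l = 0 by rewrite cE; ring.
pose f (z : state N M) := \sum_l c l * (occ z l)%:R.
have eig x : generator alpha f x = - a0 * f x by exact: centered_linear_eigenfunction.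
have expectZ (b : R) g : expect alpha (fun x => b * g x) = b * expect alpha g.
  by rewrite /expect mulr_sumr; apply: eq_bigr => x _; ring.
(* The generator has mean zero and multiplies [f] by [- a0], which is nonzero. *)
have f0 : expect alpha f = 0.
  have : expect alpha (generator alpha f) = 0 by exact: mean_gen chain_reversible f.
  rewrite (funext eig) expectZ => /eqP.
  by rewrite mulf_eq0 oppr_eq0 gt_eqF // => /eqP.
pose V := expect alpha (fun x => f x ^+ 2).
have V0 : 0 < V.
  (* A single particle at [i], where [f] takes the positive value [a j]. *)
  pose x := of_occ M (incr (fun=> 0%N) i).
  have xE : occ x = incr (fun=> 0%N) i.
    by rewrite of_occK // mass_incr /mass big1.
  have fx : f x = a j.
    by rewrite /f cE xE /incr !add0n eqxx eq_sym (negPf ij) /=; ring.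
  rewrite /V /expect (bigD1 x) //= fx ltr_pwDl //.
    by rewrite mulr_gt0 ?exprn_gt0 ?mu_gt0.
  by apply: sumr_ge0 => y _; rewrite mulr_ge0 ?sqr_ge0 // ltW ?mu_gt0.
pose s := (Num.sqrt V)^-1.
have sV : s ^+ 2 * V = 1 by rewrite exprVn sqr_sqrtr ?mulVf ?gt_eqF ?ltW.
have g1 : expect alpha (fun x => (s * f x) ^+ 2) = 1.
  by under eq_fun do rewrite exprMn; rewrite expectZ.
exists (fun x => s * f x); split => //; first by rewrite expectZ f0 mulr0.
rewrite /dirichlet -[RHS]mulr1 -g1 -expectZ -mulN1r -expectZ.
apply: eq_bigr => x _; congr (_ * _).
have -> : generator alpha (fun x => s * f x) x = s * generator alpha f x.
  by rewrite /generator [RHS]mulr_sumr; apply: eq_bigr => y _; ring.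
by rewrite eig; ring.
Qed.

(** * The lower bound and the spectral gap *)

Lemma dirichlet_ge (i0 : 'I_N) f :
  expect alpha f = 0 -> expect alpha (fun x => f x ^+ 2) = 1 ->
  a0 <= dirichlet alpha f.
Proof.
move=> f0 f1.
have [g [g0 g1] gmin] := energy_minimizer (rate alpha) mu_gt0 (conj f0 f1).
apply: le_trans (gmin f (conj f0 f1)).
have geig := minimizer_eigenfunction mu_gt0 chain_reversible (conj g0 g1) gmin.
have [[x [y gxy]]|const] := pselect (exists x y, g x != g y).
  exact: (eigenvalue_ge i0 geig gxy).
have gE x : g x = g (zero_state N M).
  by apply/eqP/negPn/negP => gx; apply: const; exists x, (zero_state N M).
(* A constant [g] of mean zero has second moment zero, contrary to its normalisation. *)
have g0' : expect alpha g = 0 by [].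
have : expect alpha (fun x => g x ^+ 2) = g (zero_state N M) * expect alpha g.
  by rewrite /expect mulr_sumr; apply: eq_bigr => x _; rewrite gE; ring.
have -> : expect alpha (fun x => g x ^+ 2) = 1 by [].
by rewrite g0' mulr0 => /eqP; rewrite oner_eq0.
Qed.

End Chain.

Theorem theorem6p1 (R : realType) (N M : nat) (alpha : 'I_N.+1 -> R) :
  (2 <= N)%N -> (N.+1 <= M)%N -> (forall i, 0 < alpha i) ->
  @irreducible R N M alpha /\ @reversible R N M alpha /\ @spectral_gap R N M alpha = alpha ord_max.
Proof.
move=> N2 NM alpha0; have M0 : (0 < M)%N by exact: leq_trans NM.
split; first exact: chain_irreducible.
split; first exact: chain_reversible.
pose i : 'I_N := Ordinal (ltnW N2); pose j : 'I_N := Ordinal N2.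
have ij : i != j by [].
have [f [f0 f1 fE]] := gap_attained M0 alpha0 ij.
have lb : lbound [set dirichlet alpha f | f in
    [set f : state N M -> R | expect alpha f = 0 /\
      expect alpha (fun x => f x ^+ 2) = 1]]%classic (alpha_last alpha).
  by move=> _ [g [g0 g1] <-]; exact: dirichlet_ge.
(* [lb] supplies the boundedness that [ge_inf] needs, and [f] the nonemptiness that [lb_le_inf]
   needs. *)
apply/eqP; rewrite eq_le; apply/andP; split.
  by apply: (ge_inf (ex_intro _ _ lb)); exists f.
by apply: lb_le_inf => //; exists (dirichlet alpha f), f.
Qed.
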